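(* Let $\mathbf{K}$ be a calculus on the set of first-order formulae such that $\mathbf{G3m}\preceq\mathbf{K}\preceq\mathbf{G3cs}$. Then: (1) For all finite lists of formulae $\Gamma$ and formulae $A$: if $\mathbf{K}\vdash\Gamma\Rightarrow\neg\neg A$, then $\mathbf{G3cs}\vdash\Gamma\Rightarrow A$. (2) The following are equivalent: (a) for all finite lists of formulae $\Gamma$ and formulae $A$, if $\mathbf{G3cs}\vdash\Gamma\Rightarrow A$, then $\mathbf{K}\vdash\Gamma\Rightarrow\neg\neg A$; (b) $\mathbf{G3g}\preceq\mathbf{K}$.
   Context: Calculi. For a set $S$, $S^*$ is the set of finite lists over $S$; a sequent is a pair $\Gamma\Rightarrow\Delta$ with $\Gamma,\Delta\in S^*$. A rule on $S$ is a rule schema with premisses $\{\Gamma_i\Rightarrow\Delta_i:i\in I\}$, $I\subseteq\mathbb N$, and conclusion $\Gamma\Rightarrow\Delta$; its instances are obtained by substituting the metavariables (subject to side conditions). A calculus is a set of rules. $\mathbf{L}\vdash\Gamma\Rightarrow\Delta$ means that there is a finite proof tree with that conclusion all of whose inferences are instances of rules of $\mathbf{L}$. A rule is admissible in $\mathbf{L}$ if for each instance, derivability in $\mathbf{L}$ of all premisses implies derivability of the conclusion. $\mathbf{L}\preceq\mathbf{M}$ means that every rule of $\mathbf{L}$ is admissible in $\mathbf{M}$. Formulae. First-order formulae over a signature of function and relation symbols, built from the atomic formulae $P^n(t_1,\dots,t_n)$, $t_1=t_2$, $\bot$, $\top$ by $\wedge,\vee,\to,\forall,\exists$; $\neg A:=A\to\bot$;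 $A[t/x]$ is substitution ($t$ free for $x$ in $A$). There are no special rules for equality. $\mathbf{G3m}$ (single-succedent; $\Gamma$ lists of formulae, $A,B,C$ formulae, $P$ atomic formulae; ''premisses / conclusion''; ''$y$ fresh'' means $y$ is not free in the conclusion): R$\top$: / $\Gamma\Rightarrow\top$. L$\vee$: $A,\Gamma\Rightarrow C$ and $B,\Gamma\Rightarrow C$ / $A\vee B,\Gamma\Rightarrow C$. R$\vee_1$: $\Gamma\Rightarrow A$ / $\Gamma\Rightarrow A\vee B$. R$\vee_2$: $\Gamma\Rightarrow B$ / $\Gamma\Rightarrow A\vee B$. L$\wedge$: $A,B,\Gamma\Rightarrow C$ / $A\wedge B,\Gamma\Rightarrow C$. R$\wedge$: $\Gamma\Rightarrow A$ and $\Gamma\Rightarrow B$ / $\Gamma\Rightarrow A\wedge B$. L$\to$: $\Gamma\Rightarrow A$ and $B,\Gamma\Rightarrow C$ / $A\to B,\Gamma\Rightarrow C$. R$\to$: $A,\Gamma\Rightarrow B$ / $\Gamma\Rightarrow A\to B$. L$\exists$: $A[y/x],\Gamma\Rightarrow C$ / $\exists x\,A,\Gamma\Rightarrow C$ ($y$ fresh). R$\exists$: $\Gamma\Rightarrow A[t/x]$ / $\Gamma\Rightarrow\exists x\,A$. L$\forall$: $A[t/x],\forall x\,A,\Gamma\Rightarrow C$ / $\forall x\,A,\Gamma\Rightarrow C$. R$\forall$: $\Gamma\Rightarrow A[y/x]$ / $\Gamma\Rightarrow\forall x\,A$ ($y$ fresh). IS: / $\Gamma_1,P,\Gamma_2\Rightarrow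 P$. LE: $\Gamma_1,A,B,\Gamma_2\Rightarrow C$ / $\Gamma_1,B,A,\Gamma_2\Rightarrow C$. $\mathrm{Cut}$: $\Gamma\Rightarrow A$ and $\Delta_1,A,\Delta_2\Rightarrow B$ / $\Delta_1,\Gamma,\Delta_2\Rightarrow B$. $\mathbf{G3cs}$ (classical logic) is $\mathbf{G3m}$ plus $\mathrm{Cut}$ and L$\neg\neg$: $A,\Gamma\Rightarrow C$ / $\neg\neg A,\Gamma\Rightarrow C$. $\mathbf{G3g}$ (Glivenko's logic) is $\mathbf{G3m}$ plus $\mathrm{Cut}$ and the two rules: $A,\Gamma\Rightarrow\neg\neg B$ / $\Gamma\Rightarrow\neg\neg(A\to B)$; and $\Gamma\Rightarrow\neg\neg A[y/x]$ / $\Gamma\Rightarrow\neg\neg\forall x\,A$ ($y$ fresh).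
   Formalization: In (2) the equivalence is stated under the added assumption that Cut is admissible in K; without it (a) need not imply (b), since G3g contains Cut. Part (1) and the direction from (b) to (a) still hold for every K. *)

(* Defs.v *)
From Stdlib Require Vector.
From Stdlib Require Import List.
Import ListNotations.

Set Implicit Arguments.
Unset Strict Implicit.
Unset Printing Implicit Defensive.

(** * Sequents, rules and calculi over an arbitrary set *)

Section Calculi.

Context {S : Type}.

Definition sequent : Type := (list S * list S)%type.

(* A rule is given by the index set I of its premisses and by the collection of
   its instances (the side conditions being part of that collection).  Only the
   values [p i] with [rule_index i] are premisses of an instance [p / c]; the
   other values of [p] are never looked at by the definitions below. *)
Record rule : Type := Rule {
  rule_index : nat -> Prop;
  rule_instance : (nat -> sequent) -> sequent -> Prop
}.

Definition calculus : Type := rule -> Prop.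

Definition finite_index (I : nat -> Prop) : Prop :=
  exists n, forall i, I i -> i < n.

(* Proof trees are finite, so that an instance with infinitely many premisses
   (which [rule] permits) is never an inference of a proof tree. *)
Inductive derivable (L : calculus) : sequent -> Prop :=
| derivable_infer (r : rule) (p : nat -> sequent) (c : sequent) :
    L r -> finite_index (rule_index r) -> rule_instance r p c ->
    (forall i, rule_index r i -> derivable L (p i)) ->
    derivable L c.

Definition admissible (r : rule) (L : calculus) : Prop :=
  forall p c, rule_instance r p c ->
    (forall i, rule_index r i -> derivable L (p i)) ->
    derivable L c.

Definition calculus_le (L M : calculus) : Prop :=
  forall r, L r -> admissible r M.

Definition of_rules (rs : list rule) : calculus := fun r => In r rs.

Definition extend (L : calculus) (rs : list rule) : calculus :=
  fun r => L r \/ In r rs.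

(* The rule with [n] premisses whose instances are the [ps / c] with [R ps c]. *)
Definition schema (n : nat) (R : list sequent -> sequent -> Prop) : rule :=
  Rule (fun i => i < n) (fun p c => R (map p (seq 0 n)) c).

End Calculi.

Arguments sequent S : clear implicits.
Arguments rule S : clear implicits.
Arguments calculus S : clear implicits.

Notation "G ==> D" := (@pair (list _) (list _) G D)
  (at level 70, no associativity).
Notation "L |-- s" := (derivable L s) (at level 75, no associativity).
Notation "L <<= M" := (calculus_le L M) (at level 75, no associativity).

(** * First-order formulae *)

Record signature : Type := Signature {
  func : Type;
  func_arity : func -> nat;
  rel : Type;
  rel_arity : rel -> nat
}.

Section Formulae.

Context {Sg : signature}.

Inductive term : Type :=
| Var (x : nat)
| App (f : func Sg) (ts : Vector.t term (func_arity f)).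

Inductive formula : Type :=
| Rel (P : rel Sg) (ts : Vector.t term (rel_arity P))
| Eq (t u : term)
| Bot
| Top
| And (A B : formula)
| Or (A B : formula)
| Imp (A B : formula)
| All (x : nat) (A : formula)
| Ex (x : nat) (A : formula).

Definition Neg (A : formula) : formula := Imp A Bot.

Definition atomic (A : formula) : Prop :=
  match A with
  | Rel _ | Eq _ _ | Bot | Top => True
  | _ => False
  end.

Inductive occurs (x : nat) : term -> Prop :=
| occurs_Var : occurs x (Var x)
| occurs_App f ts i : occurs x (Vector.nth ts i) -> occurs x (@App f ts).

Fixpoint free (x : nat) (A : formula) : Prop :=
  match A with
  | Rel ts => exists i, occurs x (Vector.nth ts i)
  | Eq t u => occurs x t \/ occurs x u
  | Bot | Top => False
  | And A B | Or A B | Imp A B => free x A \/ free x B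
  | All y A | Ex y A => x <> y /\ free x A
  end.

Fixpoint subst_term (t : term) (x : nat) (u : term) : term :=
  match u with
  | Var y => if Nat.eqb y x then t else Var y
  | App ts => App (Vector.map (subst_term t x) ts)
  end.

(* [subst A t x] is A[t/x].  Bound variables are not renamed: it is the intended
   substitution only when [free_for t x A]. *)
Fixpoint subst (A : formula) (t : term) (x : nat) : formula :=
  match A with
  | Rel ts => Rel (Vector.map (subst_term t x) ts)
  | Eq u v => Eq (subst_term t x u) (subst_term t x v)
  | Bot => Bot
  | Top => Top
  | And A B => And (subst A t x) (subst B t x)
  | Or A B => Or (subst A t x) (subst B t x)
  | Imp A B => Imp (subst A t x) (subst B t x)
  | All y A => All y (if Nat.eqb y x then A else subst A t x)
  | Ex y A => Ex y (if Nat.eqb y x then A else subst A t x)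
  end.

Fixpoint free_for (t : term) (x : nat) (A : formula) : Prop :=
  match A with
  | Rel _ | Eq _ _ | Bot | Top => True
  | And A B | Or A B | Imp A B => free_for t x A /\ free_for t x B
  | All y A | Ex y A =>
      y = x \/ (free_for t x A /\ (free x A -> ~ occurs y t))
  end.

Definition fresh (y : nat) (s : sequent formula) : Prop :=
  forall A, In A (fst s) \/ In A (snd s) -> ~ free y A.

(** * The rules *)

Definition RTop : rule formula := schema 0 (fun ps c =>
  exists G, ps = [] /\ c = (G ==> [Top])).

Definition LOr : rule formula := schema 2 (fun ps c =>
  exists G A B C,
    ps = [A :: G ==> [C]; B :: G ==> [C]] /\ c = (Or A B :: G ==> [C])).

Definition ROr1 : rule formula := schema 1 (fun ps c =>
  exists G A B, ps = [G ==> [A]] /\ c = (G ==> [Or A B])).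

Definition ROr2 : rule formula := schema 1 (fun ps c =>
  exists G A B, ps = [G ==> [B]] /\ c = (G ==> [Or A B])).

Definition LAnd : rule formula := schema 1 (fun ps c =>
  exists G A B C,
    ps = [A :: B :: G ==> [C]] /\ c = (And A B :: G ==> [C])).

Definition RAnd : rule formula := schema 2 (fun ps c =>
  exists G A B, ps = [G ==> [A]; G ==> [B]] /\ c = (G ==> [And A B])).

Definition LImp : rule formula := schema 2 (fun ps c =>
  exists G A B C,
    ps = [G ==> [A]; B :: G ==> [C]] /\ c = (Imp A B :: G ==> [C])).

Definition RImp : rule formula := schema 1 (fun ps c =>
  exists G A B, ps = [A :: G ==> [B]] /\ c = (G ==> [Imp A B])).

Definition LEx : rule formula := schema 1 (fun ps c =>
  exists G A C x y,
    free_for (Var y) x A /\ fresh y c /\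
    ps = [subst A (Var y) x :: G ==> [C]] /\ c = (Ex x A :: G ==> [C])).

Definition REx : rule formula := schema 1 (fun ps c =>
  exists G A x t,
    free_for t x A /\
    ps = [G ==> [subst A t x]] /\ c = (G ==> [Ex x A])).

Definition LAll : rule formula := schema 1 (fun ps c =>
  exists G A C x t,
    free_for t x A /\
    ps = [subst A t x :: All x A :: G ==> [C]] /\ c = (All x A :: G ==> [C])).

Definition RAll : rule formula := schema 1 (fun ps c =>
  exists G A x y,
    free_for (Var y) x A /\ fresh y c /\
    ps = [G ==> [subst A (Var y) x]] /\ c = (G ==> [All x A])).

Definition IS : rule formula := schema 0 (fun ps c =>
  exists G1 G2 P,
    atomic P /\ ps = [] /\ c = (G1 ++ P :: G2 ==> [P])).

Definition LE : rule formula := schema 1 (fun ps c =>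
  exists G1 G2 A B C,
    ps = [G1 ++ A :: B :: G2 ==> [C]] /\ c = (G1 ++ B :: A :: G2 ==> [C])).

Definition Cut : rule formula := schema 2 (fun ps c =>
  exists G D1 D2 A B,
    ps = [G ==> [A]; D1 ++ A :: D2 ==> [B]] /\ c = (D1 ++ G ++ D2 ==> [B])).

Definition LNegNeg : rule formula := schema 1 (fun ps c =>
  exists G A C,
    ps = [A :: G ==> [C]] /\ c = (Neg (Neg A) :: G ==> [C])).

Definition RNegNegImp : rule formula := schema 1 (fun ps c =>
  exists G A B,
    ps = [A :: G ==> [Neg (Neg B)]] /\ c = (G ==> [Neg (Neg (Imp A B))])).

Definition RNegNegAll : rule formula := schema 1 (fun ps c =>
  exists G A x y,
    free_for (Var y) x A /\ fresh y c /\
    ps = [G ==> [Neg (Neg (subst A (Var y) x))]] /\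
    c = (G ==> [Neg (Neg (All x A))])).

(** * The calculi *)

Definition G3m : calculus formula := of_rules
  [RTop; LOr; ROr1; ROr2; LAnd; RAnd; LImp; RImp;
   LEx; REx; LAll; RAll; IS; LE].

Definition G3cs : calculus formula := extend G3m [Cut; LNegNeg].

Definition G3g : calculus formula := extend G3m [Cut; RNegNegImp; RNegNegAll].

End Formulae.

Arguments term Sg : clear implicits.
Arguments formula Sg : clear implicits.

(* Main.v *)
Require Import Defs.
From Stdlib Require Import List Lia PeanoNat.
Import ListNotations.

(** With [Cut], the rules of [G3m] yield weakening (cut against [T]) and
    contraction (cut against [A /\ A]), hence natural deduction for minimal
    logic.  There [~~] is a monad, and the double negation of every classical
    inference is obtained by [bind] and [unit] alone, except for the right
    rules of [->] and [forall], which are the two rules of [G3g]. *)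

(** * Rules given by lists of premisses, and comparison of calculi *)

Lemma admissible_schema (S : Type) (M : calculus S) (ps : list (sequent S))
    (R : list (sequent S) -> sequent S -> Prop) (c : sequent S) :
  admissible (schema (length ps) R) M -> R ps c -> Forall (derivable M) ps ->
  M |-- c.
Proof.
  intros H HR Hps.
  (* The default [c] is never read: only indices below [length ps] are premisses. *)
  apply (H (fun i => nth i ps c)); cbn.
  - enough (E : map (fun i => nth i ps c) (seq 0 (length ps)) = ps)
      by now rewrite E.
    clear. induction ps as [|s ps IH]; [reflexivity|].
    cbn. f_equal. rewrite <- seq_shift, map_map. exact IH.
  - intros i Hi. rewrite Forall_forall in Hps. now apply Hps, nth_In.
Qed.

Lemma schema_admissible (S : Type) (M : calculus S) (n : nat)
    (R : list (sequent S) -> sequent S -> Prop) :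
  M (schema n R) -> admissible (schema n R) M.
Proof.
  intros HM p c Hi Hp.
  refine (derivable_infer HM _ Hi Hp). exists n. now intros i.
Qed.

(** Each inference of [L] is replaced, from the leaves down, by a derivation in [M]. *)
Lemma derivable_mono (S : Type) (L M : calculus S) (s : sequent S) :
  L <<= M -> L |-- s -> M |-- s.
Proof.
  intros HLM H. induction H as [r p c Hr _ Hi _ IH]. exact (HLM r Hr p c Hi IH).
Qed.

Lemma calculus_le_extend (S : Type) (L M : calculus S) (rs : list (rule S)) :
  extend L rs <<= M <-> L <<= M /\ Forall (fun r => admissible r M) rs.
Proof.
  rewrite Forall_forall. split.
  - intros H. split; intros r Hr; apply H; [now left | now right].
  - intros [H1 H2] r [Hr | Hr]; [now apply H1 | now apply H2].
Qed.

(** * Trivial substitutions and eigenvariable conditions *)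

Section Substitution.

Context {Sg : signature}.

(** A recursive proof, since the generated induction principle of [term] gives no hypothesis for the
    vector under [App]. *)
Fixpoint subst_term_id (x : nat) (u : term Sg) : subst_term (Var x) x u = u.
Proof.
  destruct u as [y | f ts]; cbn.
  - destruct (Nat.eqb_spec y x) as [-> | _]; reflexivity.
  - f_equal. induction ts as [|u n ts IH]; cbn; [reflexivity|].
    now rewrite subst_term_id, IH.
Qed.

Lemma subst_id (A : formula Sg) (x : nat) : subst A (Var x) x = A.
Proof.
  induction A; cbn; try (destruct (Nat.eqb _ _)); try congruence.
  - f_equal. induction ts as [|u n ts IH]; cbn; [reflexivity|].
    now rewrite subst_term_id, IH.
  - now rewrite !subst_term_id.
Qed.

Lemma free_for_id (A : formula Sg) (x : nat) : free_for (Var x) x A.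
Proof.
  induction A as [| | | | | | |y A IH|y A IH]; cbn; auto;
    destruct (Nat.eq_dec y x) as [E | E]; auto;
    right; split; auto; intros _ H; inversion H; auto.
Qed.

(** Carries an eigenvariable condition over to a doubly negated succedent, or back to its classical
    form. *)
Lemma fresh_succedent (y : nat) (G : list (formula Sg)) (A B : formula Sg) :
  (free y B -> free y A) -> fresh y (G ==> [A]) -> fresh y (G ==> [B]).
Proof.
  intros HAB H C [HC | [<- | []]] F.
  - exact (H C (or_introl HC) F).
  - exact (H A (or_intror (or_introl eq_refl)) (HAB F)).
Qed.

End Substitution.

Ltac solve_in := repeat (first [left; reflexivity | right]).
Ltac by_rule H ps :=
  apply (admissible_schema _ _ ps _ _ H);
  [cbn; repeat eexists; eauto | repeat apply Forall_cons; try apply Forall_nil].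
Ltac in_G3m := unfold G3m, of_rules; solve_in.

(** * Minimal natural deduction from [G3m] and [Cut] *)

Section MinimalLogic.

Context {Sg : signature} (M : calculus (formula Sg)).
(** Only admissibility is assumed, so that [M] can be [K] as well as [G3cs]. *)
Hypotheses (hG3m : G3m <<= M) (hCut : admissible Cut M).

Notation "G |- A" := (M |-- (G ==> [A])) (at level 75).

Ltac infer r ps := by_rule (hG3m r ltac:(in_G3m)) ps.

Lemma cut (G D1 D2 : list (formula Sg)) (A B : formula Sg) :
  G |- A -> D1 ++ A :: D2 |- B -> D1 ++ G ++ D2 |- B.
Proof.
  intros H1 H2. by_rule hCut [G ==> [A]; D1 ++ A :: D2 ==> [B]]; assumption.
Qed.

Lemma imp_intro (G : list (formula Sg)) (A B : formula Sg) :
  A :: G |- B -> G |- Imp A B.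
Proof. intros H. infer (@RImp Sg) [A :: G ==> [B]]; exact H. Qed.

Lemma and_intro (G : list (formula Sg)) (A B : formula Sg) :
  G |- A -> G |- B -> G |- And A B.
Proof. intros HA HB. infer (@RAnd Sg) [G ==> [A]; G ==> [B]]; assumption. Qed.

Lemma and_left (G : list (formula Sg)) (A B C : formula Sg) :
  A :: B :: G |- C -> And A B :: G |- C.
Proof. intros H. infer (@LAnd Sg) [A :: B :: G ==> [C]]; exact H. Qed.

Lemma or_intro1 (G : list (formula Sg)) (A B : formula Sg) :
  G |- A -> G |- Or A B.
Proof. intros H. infer (@ROr1 Sg) [G ==> [A]]; exact H. Qed.

Lemma or_intro2 (G : list (formula Sg)) (A B : formula Sg) :
  G |- B -> G |- Or A B.
Proof. intros H. infer (@ROr2 Sg) [G ==> [B]]; exact H. Qed.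

Lemma or_left (G : list (formula Sg)) (A B C : formula Sg) :
  A :: G |- C -> B :: G |- C -> Or A B :: G |- C.
Proof.
  intros HA HB. infer (@LOr Sg) [A :: G ==> [C]; B :: G ==> [C]]; assumption.
Qed.

Lemma imp_left (G : list (formula Sg)) (A B C : formula Sg) :
  G |- A -> B :: G |- C -> Imp A B :: G |- C.
Proof. intros HA HB. infer (@LImp Sg) [G ==> [A]; B :: G ==> [C]]; assumption. Qed.

Lemma ex_intro_term (G : list (formula Sg)) (A : formula Sg) (x : nat) (t : term Sg) :
  free_for t x A -> G |- subst A t x -> G |- Ex x A.
Proof. intros Ht H. infer (@REx Sg) [G ==> [subst A t x]]; exact H. Qed.

Lemma ex_left (G : list (formula Sg)) (A C : formula Sg) (x y : nat) :
  free_for (Var y) x A -> fresh y (Ex x A :: G ==> [C]) ->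
  subst A (Var y) x :: G |- C -> Ex x A :: G |- C.
Proof.
  intros Hy Hf H. infer (@LEx Sg) [subst A (Var y) x :: G ==> [C]]; exact H.
Qed.

Lemma all_left (G : list (formula Sg)) (A C : formula Sg) (x : nat) (t : term Sg) :
  free_for t x A -> subst A t x :: All x A :: G |- C -> All x A :: G |- C.
Proof.
  intros Ht H. infer (@LAll Sg) [subst A t x :: All x A :: G ==> [C]]; exact H.
Qed.

Lemma all_intro (G : list (formula Sg)) (A : formula Sg) (x y : nat) :
  free_for (Var y) x A -> fresh y (G ==> [All x A]) ->
  G |- subst A (Var y) x -> G |- All x A.
Proof. intros Hy Hf H. infer (@RAll Sg) [G ==> [subst A (Var y) x]]; exact H. Qed.

Lemma exchange (G1 G2 : list (formula Sg)) (A B C : formula Sg) :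
  G1 ++ A :: B :: G2 |- C -> G1 ++ B :: A :: G2 |- C.
Proof. intros H. infer (@LE Sg) [G1 ++ A :: B :: G2 ==> [C]]; exact H. Qed.

Lemma atomic_ax (G1 G2 : list (formula Sg)) (P : formula Sg) :
  atomic P -> G1 ++ P :: G2 |- P.
Proof. intros HP. infer (@IS Sg) (@nil (sequent (formula Sg))). Qed.

Lemma top_intro (G : list (formula Sg)) : G |- Top.
Proof. infer (@RTop Sg) (@nil (sequent (formula Sg))). Qed.

(* In the context [T] a bound variable of [A] can serve as its own eigenvariable,
   so the induction needs no renaming; [T] is then cut for an arbitrary context. *)
Lemma head_ax (A : formula Sg) (G : list (formula Sg)) : A :: G |- A.
Proof.
  assert (S : forall B D, [B; Top] |- B -> B :: D |- B).
  { intros B D H. rewrite <- (app_nil_r D).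
    exact (cut _ [B] [] _ _ (top_intro D) H). }
  apply S. clear G.
  induction A as [P ts|t u| | |A IHA B IHB|A IHA B IHB|A IHA B IHB|x A IH|x A IH];
    try (apply (atomic_ax []); exact I).
  - apply and_left, and_intro; [now apply S|].
    apply (exchange []). now apply S.
  - apply or_left; [apply or_intro1 | apply or_intro2]; assumption.
  - apply imp_intro, (exchange []), imp_left; now apply S.
  - apply all_intro with x; [apply free_for_id| |rewrite subst_id].
    + intros B HB. cbn in HB. intuition (subst; cbn in *; tauto).
    + apply all_left with (Var x); [apply free_for_id|].
      rewrite subst_id. now apply S.
  - apply ex_left with x; [apply free_for_id| |rewrite subst_id].
    + intros B HB. cbn in HB. intuition (subst; cbn in *; tauto).
    + apply ex_intro_term with (Var x); [apply free_for_id|].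
      now rewrite subst_id.
Qed.

(** [A] is cut against [B, A ==> A], which leaves [B] in front of [G]. *)
Lemma weaken_head (G : list (formula Sg)) (A B : formula Sg) :
  G |- A -> B :: G |- A.
Proof.
  intros H. rewrite <- (app_nil_r G).
  apply (cut _ [B] [] A A H), (exchange []), head_ax.
Qed.

Lemma ax (G : list (formula Sg)) (A : formula Sg) : In A G -> G |- A.
Proof.
  induction G as [|B G IH]; intros H; [destruct H|].
  destruct H as [-> | H]; [apply head_ax | now apply weaken_head, IH].
Qed.

(* The additive [RAnd] followed by a single cut avoids contraction. *)
Lemma modus_ponens (G : list (formula Sg)) (A B : formula Sg) :
  G |- Imp A B -> G |- A -> G |- B.
Proof.
  intros HAB HA. rewrite <- (app_nil_r G).
  apply (cut _ [] [] (And (Imp A B) A)); [now apply and_intro|].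
  apply and_left, imp_left; apply head_ax.
Qed.

(** All structural rules at once: the formulae of [G] are moved into implications, whose antecedents
    are then discharged by axioms over [D]. *)
Lemma weakening (G D : list (formula Sg)) (A : formula Sg) :
  incl G D -> G |- A -> D |- A.
Proof.
  revert A. induction G as [|B G IH]; intros A HGD H.
  - clear HGD. induction D; [exact H | now apply weaken_head].
  - apply incl_cons_inv in HGD as [HB HGD].
    apply modus_ponens with B; [|now apply ax].
    now apply IH, imp_intro.
Qed.

Lemma neg_neg_unit (G : list (formula Sg)) (A : formula Sg) :
  G |- A -> G |- Neg (Neg A).
Proof.
  intros H. apply imp_intro, modus_ponens with A; [apply head_ax|].
  now apply weaken_head.
Qed.

Lemma neg_neg_bind (G : list (formula Sg)) (A B : formula Sg) :
  G |- Neg (Neg A) -> A :: G |- Neg (Neg B) -> G |- Neg (Neg B).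
Proof.
  intros HA HB. apply imp_intro.
  (* Under [Neg B] it remains to refute [A]; given [A], the second premiss contradicts [Neg B]. *)
  apply modus_ponens with (Neg A); [now apply weaken_head|].
  apply imp_intro, modus_ponens with (Neg B); [|apply ax; cbn; auto].
  apply weakening with (2 := HB). intros C HC. cbn in *. tauto.
Qed.

End MinimalLogic.

(** * Double negation elimination in [G3cs] *)

Lemma G3m_le_G3cs (Sg : signature) : @G3m Sg <<= @G3cs Sg.
Proof.
  intros r Hr p c Hi Hp. refine (derivable_infer (or_introl Hr) _ Hi Hp).
  unfold G3m, of_rules in Hr. cbn in Hr.
  (* Going through the rules one by one exposes the number of premisses, which bounds the index
     set. *)
  repeat (destruct Hr as [<- | Hr]; [eexists; intros i Hi'; exact Hi'|]).
  destruct Hr.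
Qed.

Lemma G3cs_cut (Sg : signature) : admissible (@Cut Sg) (@G3cs Sg).
Proof. apply schema_admissible. right. cbn; auto. Qed.

Lemma G3cs_neg_neg_elim (Sg : signature) (G : list (formula Sg)) (A : formula Sg) :
  G3cs |-- (G ==> [Neg (Neg A)]) -> G3cs |-- (G ==> [A]).
Proof.
  intros H. rewrite <- (app_nil_r G).
  apply (cut _ (@G3cs_cut Sg) _ [] [] _ _ H). cbn.
  assert (E : admissible (@LNegNeg Sg) G3cs)
    by (apply schema_admissible; right; cbn; auto).
  by_rule E [[A] ==> [A]]. apply head_ax; [apply G3m_le_G3cs | apply G3cs_cut].
Qed.

(** * Glivenko's theorem and the equivalence *)

Ltac premises IH E :=
  injection E; clear E; intros;
  repeat match goal with
  | E : ?p ?i = _ |- _ => apply IH in E; [|cbn; lia]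
  end.

(** Induction on the classical derivation, doubly negating succedents only. [LOr], [LAnd], [LEx],
    [LAll] and [LE] allow any succedent and so apply unchanged. *)
Lemma glivenko (Sg : signature) (K : calculus (formula Sg)) :
  G3g <<= K -> forall (G : list (formula Sg)) (A : formula Sg),
  G3cs |-- (G ==> [A]) -> K |-- (G ==> [Neg (Neg A)]).
Proof.
  intros HK G A H.
  apply calculus_le_extend in HK as [Hm HK].
  inversion HK as [|? ? hCut HK']; subst; clear HK.
  inversion HK' as [|? ? hImp HK]; subst; clear HK'.
  inversion HK as [|? ? hAll _]; subst; clear HK.
  remember (G ==> [A]) as s eqn:Es. revert G A Es.
  induction H as [r p c Hr _ Hi _ IH]; intros G0 A0 ->.
  (* One case per rule, in the order in which [G3m] and then [[Cut; LNegNeg]] list them. *)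
  destruct Hr as [Hr | Hr]; cbn in Hr;
    repeat (destruct Hr as [<- | Hr]; [cbn in Hi|]); try destruct Hr.
  - destruct Hi as (G & _ & [= -> ->]).
    now apply neg_neg_unit, top_intro.
  - destruct Hi as (G & A & B & C & E & [= -> ->]). premises IH E.
    now apply or_left.
  - destruct Hi as (G & A & B & E & [= -> ->]). premises IH E.
    apply neg_neg_bind with A; trivial.
    now apply neg_neg_unit, or_intro1, head_ax.
  - destruct Hi as (G & A & B & E & [= -> ->]). premises IH E.
    apply neg_neg_bind with B; trivial.
    now apply neg_neg_unit, or_intro2, head_ax.
  - destruct Hi as (G & A & B & C & E & [= -> ->]). premises IH E.
    now apply and_left.
  - destruct Hi as (G & A & B & E & [= -> ->]). premises IH E.
    apply neg_neg_bind with A; trivial.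
    apply neg_neg_bind with B; trivial; [now apply weaken_head|].
    apply neg_neg_unit, and_intro; trivial; apply ax; cbn; auto.
  - destruct Hi as (G & A & B & C & E & [= -> ->]). premises IH E.
    (* The left premiss gives only [Neg (Neg A)]; binding it puts [A] into the context, where [LImp]
       can use it. *)
    apply neg_neg_bind with A; trivial; [now apply weaken_head|].
    apply (exchange _ Hm []), imp_left; trivial; [now apply head_ax|].
    apply (exchange _ Hm []). now apply weaken_head.
  - destruct Hi as (G & A & B & E & [= -> ->]). premises IH E.
    by_rule hImp [A :: G ==> [Neg (Neg B)]]; assumption.
  - destruct Hi as (G & A & C & x & y & Hy & Hf & E & [= -> ->]). premises IH E.
    apply ex_left with y; trivial.
    apply fresh_succedent with (2 := Hf). cbn. tauto.
  - destruct Hi as (G & A & x & t & Ht & E & [= -> ->]). premises IH E.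
    apply neg_neg_bind with (subst A t x); trivial.
    apply neg_neg_unit, ex_intro_term with t; trivial. now apply head_ax.
  - destruct Hi as (G & A & C & x & t & Ht & E & [= -> ->]). premises IH E.
    now apply all_left with t.
  - destruct Hi as (G & A & x & y & Hy & Hf & E & [= -> ->]). premises IH E.
    assert (Hf' : fresh y (G ==> [Neg (Neg (All x A))]))
      by (apply fresh_succedent with (2 := Hf); cbn; tauto).
    by_rule hAll [G ==> [Neg (Neg (subst A (Var y) x))]]; assumption.
  - destruct Hi as (G1 & G2 & P & HP & _ & [= -> ->]).
    now apply neg_neg_unit, atomic_ax.
  - destruct Hi as (G1 & G2 & A & B & C & E & [= -> ->]). premises IH E.
    now apply exchange.
  - destruct Hi as (G & D1 & D2 & A & B & E & [= -> ->]). premises IH E.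
    (* Binding is [Cut] under double negation; [weakening] moves [A] to the front and adds the
       missing context. *)
    apply neg_neg_bind with A; trivial.
    + apply weakening with G; trivial. auto using incl_appl, incl_appr, incl_refl.
    + apply weakening with (D1 ++ A :: D2); trivial.
      intros C. cbn. rewrite !in_app_iff. cbn. tauto.
  - destruct Hi as (G & A & C & E & [= -> ->]). premises IH E.
    (* The principal formula is itself the double negation to bind. *)
    apply neg_neg_bind with A; trivial; [now apply head_ax|].
    apply (exchange _ Hm []). now apply weaken_head.
Qed.

(** Part (2) is relative to admissibility of [Cut] in [K]: [Cut] belongs to [G3g] and has arbitrary
    succedents, whereas (a) yields only doubly negated ones. *)
Theorem proposition3p9 (Sg : signature) (K : calculus (formula Sg))
    (hG3mK : G3m <<= K) (hKG3cs : K <<= G3cs) :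
  (forall (G : list (formula Sg)) (A : formula Sg),
      K |-- (G ==> [Neg (Neg A)]) -> G3cs |-- (G ==> [A])) /\
  (admissible Cut K ->
    ((forall (G : list (formula Sg)) (A : formula Sg),
        G3cs |-- (G ==> [A]) -> K |-- (G ==> [Neg (Neg A)]))
     <-> G3g <<= K)).
Proof.
  assert (part1 : forall (G : list (formula Sg)) (A : formula Sg),
      K |-- (G ==> [Neg (Neg A)]) -> G3cs |-- (G ==> [A])).
  { intros G A H. now apply G3cs_neg_neg_elim, (derivable_mono _ K). }
  split; [exact part1|]. intros hCut. split; [|apply glivenko].
  intros Ha. apply calculus_le_extend. split; [exact hG3mK|].
  repeat apply Forall_cons; [exact hCut| | |apply Forall_nil].
  (* Detour through [G3cs]: part (1) strips the premiss of its double negation, the classical right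
     rule applies, and (a) restores the double negation in [K]. *)
  - intros p c Hi Hp. cbn in Hi.
    destruct Hi as (G & A & B & E & ->). injection E as E.
    apply Ha, imp_intro; [apply G3m_le_G3cs|].
    apply part1. rewrite <- E. apply Hp. cbn. lia.
  (* The same detour with [RAll]; its eigenvariable stays fresh once the double negation is
     removed. *)
  - intros p c Hi Hp. cbn in Hi.
    destruct Hi as (G & A & x & y & Hy & Hf & E & ->). injection E as E.
    apply Ha, all_intro with y; [apply G3m_le_G3cs|exact Hy| |].
    + apply fresh_succedent with (2 := Hf). cbn. tauto.
    + apply part1. rewrite <- E. apply Hp. cbn. lia.
Qed.
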